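(* Assume that $X_0\in L^\infty$. For every $\beta\in\mathbb{R}$ and $\lambda>0$, let $$Q^*_{\beta,\lambda}(s)= \beta+{\left(-\widehat H_{\beta,\lambda}^\prime(s)\right)^+-\lambda Q_\rho((1-s)-)\over 2},\quad s\in[0,1),$$ where $H_{\beta,\lambda}(s)=\int_0^s(2\beta-\lambda Q_\rho(1-t)-2Q_0(t))dt$ for $s\in[0,1]$ and $\widehat H_{\beta,\lambda}$ is the concave envelope of $H_{\beta,\lambda}$. Then $Q^*_{\beta,\lambda}$ is the unique solution to the problem $$\min_{Q\in\mathscr{Q}}\ \int_0^1(Q(s)-\beta)^2ds+\lambda\int_0^1Q(s)Q_\rho(1-s)ds\quad\text{subject to } Q\succeq_{\mathrm{icx}}Q_0.$$
   Context: Setting: complete nonatomic probability space; $\rho\in L^2$ is the stochastic discount factor with $\rho>0$ a.s. and $\mathrm{Var}[\rho]>0$; $Q_X$ is the upper quantile function of $X$, $Q_0=Q_{X_0}$. $\mathscr{Q}$ is the set of increasing right-continuous $Q:[0,1)\to\mathbb{R}$ with $\int_0^1Q^2<\infty$. For $Q_1,Q_2\in\mathscr{Q}$, $Q_1\succeq_{\mathrm{icx}}Q_2$ means $\int_t^1Q_1(s)ds\ge\int_t^1Q_2(s)ds$ for all $t\in[0,1]$. The concave envelope $\widehat H$ of $H$ is the smallest concave function on $[0,1]$ dominating $H$; primes denote right derivatives.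
   Formalization: The class 𝒬, the function Q* and its uniqueness are taken on (0,1) instead of [0,1), because Q*(0) involves Q_ρ(1−), which is +∞ when ρ is unbounded, so that Q* is then not real-valued at s=0. *)

(* Defs.v *)
From HB Require Import structures.
From mathcomp Require Import all_boot all_order all_algebra.
From mathcomp Require Import all_classical all_reals all_analysis.
Set Implicit Arguments. Unset Strict Implicit. Unset Printing Implicit Defensive.
Import Order.TTheory GRing.Theory Num.Theory.
Import numFieldNormedType.Exports.
Local Open Scope classical_set_scope.
Local Open Scope ring_scope.

Section defs.
Variable R : realType.

Local Notation mu := (@lebesgue_measure R).

Definition oo01 : set R := `]0, 1[.
Definition ooT1 (t : R) : set R := `]t, 1[.

Definition nonatomic d (T : measurableType d) (P : probability T R) : Prop :=
  forall A : set T, measurable A -> (0 < P A)%E ->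
    exists2 B : set T, measurable B /\ B `<=` A & (0 < P B)%E /\ (P B < P A)%E.

Definition upper_quantile d (T : measurableType d) (P : probability T R)
    (X : T -> R) (s : R) : R :=
  inf [set x : R | (s%:E < P [set w | (X w <= x)%R])%E].

Definition inQ (Q : R -> R) : Prop :=
  {in `]0, 1[%R &, {homo Q : x y / x <= y}} /\
  (forall s, 0 < s < 1 -> Q x @[x --> s^'+] --> Q s) /\
  (\int[mu]_(s in oo01) ((Q s) ^+ 2)%:E < +oo)%E.

Definition icx_ge (Q1 Q2 : R -> R) : Prop :=
  forall t, 0 <= t <= 1 ->
    (\int[mu]_(s in ooT1 t) (Q2 s)%:E <= \int[mu]_(s in ooT1 t) (Q1 s)%:E)%E.

Definition objective (Qrho : R -> R) (beta lambda : R) (Q : R -> R) : \bar R :=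
  (\int[mu]_(s in oo01) ((Q s - beta) ^+ 2)%:E
   + lambda%:E * \int[mu]_(s in oo01) (Q s * Qrho (1 - s))%:E)%E.

Definition is_solution (Q0 Qrho : R -> R) (beta lambda : R) (Q : R -> R) : Prop :=
  [/\ inQ Q, icx_ge Q Q0 &
      forall Q', inQ Q' -> icx_ge Q' Q0 ->
        (objective Qrho beta lambda Q <= objective Qrho beta lambda Q')%E].

Definition concave01 (g : R -> R) : Prop :=
  forall x y t, 0 <= x <= 1 -> 0 <= y <= 1 -> 0 <= t <= 1 ->
    t * g x + (1 - t) * g y <= g (t * x + (1 - t) * y).

Definition concave_envelope (H : R -> R) (s : R) : R :=
  inf [set g s | g in [set g : R -> R | concave01 g /\
                        forall x, 0 <= x <= 1 -> H x <= g x]].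

Definition right_deriv (f : R -> R) (s : R) : R :=
  lim ((fun h => (f (s + h) - f s) / h) @ 0^'+).

Definition left_lim (f : R -> R) (s : R) : R := lim (f x @[x --> s^'-]).

Definition Hfun (Q0 Qrho : R -> R) (beta lambda : R) (s : R) : R :=
  Rintegral mu `[0, s] (fun t => 2 * beta - lambda * Qrho (1 - t) - 2 * Q0 t).

Definition Qstar (Q0 Qrho : R -> R) (beta lambda : R) (s : R) : R :=
  beta + (Num.max (- right_deriv (concave_envelope (Hfun Q0 Qrho beta lambda)) s) 0
          - lambda * left_lim Qrho (1 - s)) / 2.

End defs.

(* Main.v *)
Require Import Defs.
From HB Require Import structures.
From mathcomp Require Import all_boot all_order all_algebra.
From mathcomp Require Import all_classical all_reals all_analysis.
From mathcomp Require Import measurable_realfun ring lra.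
Import Order.TTheory GRing.Theory Num.Theory.
Import numFieldNormedType.Exports.
Local Open Scope classical_set_scope.
Local Open Scope ring_scope.
Set Implicit Arguments.
Unset Strict Implicit.
Unset Printing Implicit Defensive.

(** Write [m] for the positive part of minus the right derivative of the concave
    envelope [G] of [H], so that [2 (Q* - beta) + lambda q = m] with
    [q s = Q_rho ((1 - s)-)]. Expanding the square, the cost of [Q] is the cost
    of [Q*] plus [\int (Q - Q* )^2] plus [\int (Q - Q* ) m]. As [m] is nonnegative
    and nondecreasing, the last term is an average over [u >= 0] of the integrals
    of [Q - Q*] over [{m > u}]; up to points where [m = u] this set is [(t, 1)]
    for any maximiser [t] of [H s + u s]. There [G t = H t] and
    [\int_t^1 m = G t - G 1], whence [\int_t^1 Q* = \int_t^1 Q_0], and the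
    constraint on [Q] makes each of these integrals nonnegative. Feasibility of
    [Q*] is [G >= H] together with [\int_t^1 m >= G t - G 1]. *)

(** * Right derivatives of concave functions, concave envelopes, and a telescoping estimate *)

Section concave.
Variable R : realType.
Implicit Types G H : R -> R.

(** Clearing the denominator [z - x] keeps the degenerate case [x = z] in the statement. *)
Lemma concave01_chord G (x y z : R) : concave01 G ->
  0 <= x -> x <= y -> y <= z -> z <= 1 ->
  G x * (z - y) + G z * (y - x) <= G y * (z - x).
Proof.
move=> cG x0 xy yz z1.
have [xz|xz] := ltP x z; last first.
  have -> : y = x by lra.
  have -> : z = x by lra.
  by rewrite subrr !mulr0 addr0.
pose t := (z - y) / (z - x).
have zx : z - x != 0 by rewrite subr_eq0 gt_eqF.
have t01 : 0 <= t <= 1.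
  by rewrite /t divr_ge0 ?subr_ge0 ?(ltW xz)//= ler_pdivrMr ?subr_gt0// mul1r lerB.
have x01 : 0 <= x <= 1 by rewrite x0 (le_trans (ltW xz)).
have z01 : 0 <= z <= 1 by rewrite z1 (le_trans x0 (ltW xz)).
have := cG x z t x01 z01 t01.
have -> : t * x + (1 - t) * z = y by rewrite /t; field.
rewrite -(ler_pM2r (_ : 0 < z - x)) ?subr_gt0//; apply: le_trans.
by rewrite le_eqVlt; apply/predU1P; left; rewrite /t; field.
Qed.

Lemma concave_slope_nonincreasing G (s : R) : concave01 G -> 0 < s < 1 ->
  {in `]0, (1 - s)] &, nonincreasing_fun (fun h => (G (s + h) - G s) / h)}.
Proof.
move=> cG /andP[s0 s1] h k; rewrite !in_itv/= => /andP[h0 hs] /andP[k0 ks] hk.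
rewrite ler_pdivrMr// mulrAC ler_pdivlMr//.
have sh : s <= s + h by lra.
have shk : s + h <= s + k by lra.
have sk1 : s + k <= 1 by lra.
have := concave01_chord cG (ltW s0) sh shk sk1; nra.
Qed.

Lemma concave_slope_ub G (s x y : R) : concave01 G -> 0 < s < 1 ->
  0 <= x < s -> s < y <= 1 -> (G y - G s) / (y - s) <= (G s - G x) / (s - x).
Proof.
move=> cG /andP[s0 s1] /andP[x0 xs] /andP[sy y1].
rewrite ler_pdivrMr ?subr_gt0// mulrAC ler_pdivlMr ?subr_gt0//.
have := @concave01_chord G x s y cG x0 (ltW xs) (ltW sy) y1; nra.
Qed.

Lemma has_sup_slope G (s : R) : concave01 G -> 0 < s < 1 ->
  has_sup [set (G (s + h) - G s) / h | h in `]0, (1 - s)]].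
Proof.
move=> cG s01; move: (s01) => /andP[s0 s1]; split.
  by exists ((G (s + (1 - s)) - G s) / (1 - s)), (1 - s) => //=; rewrite in_itv/=; lra.
(* The slope over [[0, s]] bounds every slope to the right of [s]. *)
exists ((G s - G 0) / (s - 0)) => _ [h /= + <-]; rewrite in_itv/= => /andP[h0 hs].
have := @concave_slope_ub G s 0 (s + h) cG s01.
have -> : s + h - s = h by ring.
by apply; lra.
Qed.

(** Slopes increase as [h] decreases to [0] and are bounded above, so the [lim] in [right_deriv] is
    a genuine limit; the bounds below are read off this supremum. *)
Lemma right_deriv_concave G (s : R) : concave01 G -> 0 < s < 1 ->
  right_deriv G s = sup [set (G (s + h) - G s) / h | h in `]0, (1 - s)]].
Proof.
move=> cG s01; rewrite /right_deriv; apply: cvg_lim => //.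
have [_ ubs] := has_sup_slope cG s01.
apply: (@nonincreasing_at_right_cvgr _ _ _ (BRight (1 - s))) => //.
  by rewrite bnd_simp; lra.
exact: concave_slope_nonincreasing.
Qed.

Lemma concave_le_right_deriv G (s y : R) : concave01 G -> 0 < s < 1 ->
  s <= y <= 1 -> G y - G s <= right_deriv G s * (y - s).
Proof.
move=> cG s01 /andP[]; rewrite le_eqVlt => /predU1P[<- _|sy y1].
  by rewrite !subrr mulr0.
rewrite -ler_pdivrMr ?subr_gt0// right_deriv_concave//.
have [_ ubs] := has_sup_slope cG s01.
apply: ub_le_sup => //; exists (y - s) => /=; first by rewrite in_itv/=; lra.
by have -> : s + (y - s) = y by ring.
Qed.

Lemma concave_ge_right_deriv G (x s : R) : concave01 G -> 0 < s < 1 ->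
  0 <= x <= s -> right_deriv G s * (s - x) <= G s - G x.
Proof.
move=> cG s01 /andP[x0]; rewrite le_eqVlt => /predU1P[->|xs].
  by rewrite !subrr mulr0.
rewrite -ler_pdivlMr ?subr_gt0// right_deriv_concave//.
apply: ge_sup; first by case: (has_sup_slope cG s01).
move=> _ [h /= + <-]; rewrite in_itv/= => /andP[h0 hs].
have := @concave_slope_ub G s x (s + h) cG s01.
have -> : s + h - s = h by ring.
by apply; lra.
Qed.

Lemma right_deriv_concave_le G (s c : R) : concave01 G -> 0 < s < 1 ->
  (forall y, s < y <= 1 -> G y - G s <= c * (y - s)) -> right_deriv G s <= c.
Proof.
move=> cG s01 Gc; rewrite right_deriv_concave//.
apply: ge_sup; first by case: (has_sup_slope cG s01).
move=> _ [h /= + <-]; rewrite in_itv/= => /andP[h0 hs].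
rewrite ler_pdivrMr//; have := Gc (s + h).
have -> : s + h - s = h by ring.
by apply; lra.
Qed.

(** The slope of the chord over [[x, y]] lies between the two derivatives. *)
Lemma right_deriv_nonincreasing G (x y : R) : concave01 G ->
  0 < x -> x <= y -> y < 1 -> right_deriv G y <= right_deriv G x.
Proof.
move=> cG x0; rewrite le_eqVlt => /predU1P[->//|xy y1].
rewrite -(ler_pM2r (_ : 0 < y - x)) ?subr_gt0//.
apply: (le_trans (concave_ge_right_deriv cG _ _)); [lra|lra|].
apply: concave_le_right_deriv => //; lra.
Qed.

Lemma right_deriv_right_continuous G (s : R) : concave01 G -> 0 < s < 1 ->
  right_deriv G x @[x --> s^'+] --> right_deriv G s.
Proof.
move=> cG s01; apply/cvgrPdist_le => e e0.
have [|_ [h /= + <-]] := sup_adherent (_ : 0 < e / 2) (has_sup_slope cG s01).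
  by rewrite divr_gt0.
rewrite in_itv/= => /andP[h0 hs].
rewrite -right_deriv_concave// ltr_pdivlMr// => hG.
near=> x.
have sx : s < x by near: x; exact: nbhs_right_gt.
(* In the first half of [[s, s + h]] one has [s + h - x > h / 2]. A drop of [right_deriv G] by more
   than [e] would then cost the increment [G (s + h) - G s] more than [e * h / 2], against the
   choice of [h]. *)
have xh : x < s + h / 2.
  by near: x; apply: nbhs_right_lt; rewrite ltrDl divr_gt0.
have gx : right_deriv G x <= right_deriv G s.
  by apply: right_deriv_nonincreasing => //; lra.
rewrite ger0_norm ?subr_ge0//.
have x01 : 0 < x < 1 by lra.
have xsh : x <= s + h <= 1 by lra.
have sx1 : s <= x <= 1 by lra.
have H1 := concave_le_right_deriv cG x01 xsh.
have H2 := concave_le_right_deriv cG s01 sx1.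
rewrite leNgt; apply/negP => H3.
have : right_deriv G x * (s + h - x) <= (right_deriv G s - e) * (s + h - x).
  by rewrite ler_pM2r; lra.
nra.
Unshelve. all: by end_near. Qed.

Section envelope.
Variables (H : R -> R) (a b : R).
Hypothesis Hab : forall x, 0 <= x <= 1 -> H x <= a + b * x.

Lemma affine_concave01 (c e : R) : concave01 (fun x => c + e * x).
Proof. by move=> x y t _ _ _; rewrite le_eqVlt; apply/predU1P; left; ring. Qed.

(** The affine majorant guarantees that the infimum defining the envelope is taken over a nonempty
    set and is not a default value. *)
Let env_nonempty s : [set g s | g in [set g : R -> R | concave01 g /\
   forall x, 0 <= x <= 1 -> H x <= g x]] !=set0.
Proof.
exists (a + b * s), (fun x => a + b * x) => //; split => //.
exact: affine_concave01.
Qed.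

Lemma le_concave_envelope s : 0 <= s <= 1 -> H s <= concave_envelope H s.
Proof. by move=> s01; apply: lb_le_inf => // _ [g [_ +] <-]; exact. Qed.

Lemma concave_envelope_le g s : concave01 g ->
  (forall x, 0 <= x <= 1 -> H x <= g x) -> 0 <= s <= 1 ->
  concave_envelope H s <= g s.
Proof.
move=> cg Hg s01; apply: ge_inf; last by exists g.
by exists (H s) => _ [g' [_ +] <-]; exact.
Qed.

Lemma concave_envelope_concave01 : concave01 (concave_envelope H).
Proof.
move=> x y t x01 y01 t01; apply: lb_le_inf => // _ [g [cg Hg] <-].
apply: le_trans (cg x y t x01 y01 t01).
by apply: lerD; apply: ler_wpM2l; rewrite ?concave_envelope_le//; lra.
Qed.

End envelope.

Lemma le0_of_le_divn (x C : R) : (forall n, x <= C / n.+1%:R) -> x <= 0.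
Proof.
move=> xC; apply/ler_addgt0Pr => e e0; rewrite add0r.
have [|n] := @ltr_add_invr R 0 (e / (`|C| + 1)).
  by apply: divr_gt0 => //; have := normr_ge0 C; lra.
rewrite add0r ltr_pdivlMr; last by have := normr_ge0 C; lra.
move=> hn; apply: (le_trans (xC n)); rewrite ltW// mulrC.
apply: le_lt_trans hn; rewrite ler_pM2l ?invr_gt0 ?ltr0n//.
by have := ler_norm C; lra.
Qed.

(* Telescoping over the regular n-fold subdivision gives
   [F b - F a <= (v b - v a) * (b - a) / n]. *)
Lemma le_of_increment_le (F v : R -> R) (a b : R) : a <= b ->
  (forall x y, a <= x -> x < y -> y <= b -> F y - F x <= (v y - v x) * (y - x)) ->
  F b <= F a.
Proof.
rewrite le_eqVlt => /predU1P[->//|ab] hF.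
rewrite -subr_le0; apply: (@le0_of_le_divn _ ((v b - v a) * (b - a))) => n.
pose d := (b - a) / n.+1%:R; pose x (i : nat) : R := a + d * i%:R.
have d0 : 0 < d by rewrite divr_gt0 ?subr_gt0 ?ltr0n.
have xn : x n.+1 = b by rewrite /x /d divfK ?pnatr_eq0// addrC subrK.
have x0 : x 0%N = a by rewrite /x mulr0 addr0.
have dx i : x i.+1 - x i = d by rewrite /x -natr1; ring.
have xm i j : (i <= j)%N -> x i <= x j.
  by move=> ij; rewrite /x lerD2l ler_pM2l// ler_nat.
have : forall i, (i <= n.+1)%N -> F (x i) - F a <= (v (x i) - v a) * d.
  elim=> [_|i IH lin]; first by rewrite x0 !subrr mul0r.
  have xi : a <= x i by rewrite -x0 xm.
  have xiS : x i < x i.+1 by rewrite -subr_gt0 dx.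
  have xSn : x i.+1 <= b by rewrite -xn xm.
  have := hF _ _ xi xiS xSn; have := IH (ltnW lin); rewrite dx; lra.
by move=> /(_ _ (leqnn _)); rewrite xn /d mulrA.
Qed.

End concave.

(** * Integrals over subintervals of []0, 1[], square integrability, and the layer argument *)

Section integration.
Variable R : realType.
Notation mu := (@lebesgue_measure R).
Notation int01 f := (mu.-integrable `]0, 1[ (EFin \o f)).
Notation J f x y := (Rintegral mu `]x, y[ f).
Implicit Types f g : R -> R.

(** The points of [D] where [f] is at least [r] form an interval. *)
Lemma nondecreasing_in_measurable f (D : set R) : is_interval D ->
  {in D &, {homo f : x y / x <= y}} -> measurable_fun D f.
Proof.
move=> iD fD.
apply: (measurability (@RGenCInfty.G R)) => [|/= _ [_] [r] -> <-].
  exact: RGenCInfty.measurableE.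
apply: is_interval_measurable => s t/= [Ds].
rewrite in_itv/= andbT => fs [Dt]; rewrite in_itv/= andbT => ft u sut.
have Du : D u by exact: iD sut.
split => //; rewrite in_itv/= andbT (le_trans fs)// fD ?inE//.
by case/andP: sut.
Qed.

Lemma integrable_itv f (x y : R) : int01 f -> 0 <= x -> y <= 1 ->
  mu.-integrable `]x, y[ (EFin \o f).
Proof.
move=> fi x0 y1; apply: integrableS fi => //; apply: subset_itv; by rewrite bnd_simp.
Qed.

Lemma RintegralD_itv f (x y z : R) : int01 f ->
  0 <= x -> x <= y -> y <= z -> z <= 1 -> J f x z = J f x y + J f y z.
Proof.
move=> fi x0 xy yz z1.
have fxz : mu.-integrable `]x, z[ (EFin \o f) by exact: integrable_itv.
have [->|yz'] := eqVneq y z.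
  by rewrite [X in _ + X]Rintegral_mkcond set_itvoo0 -?Rintegral_mkcond ?Rintegral_set0 ?addr0.
rewrite -(Rintegral_itvB (x := y) fxz) ?bnd_simp//; last by rewrite lt_neqAle yz'.
rewrite (@Rintegral_itv_bndo_bndc _ _ y); first by ring.
by apply: integrable_itv => //; exact: le_trans z1.
Qed.

Lemma Rintegral_itv_cst (c x y : R) : x <= y -> J (cst c) x y = c * (y - x).
Proof.
move=> xy; rewrite Rintegral_cst//= lebesgue_measure_itv/= lte_fin.
case: ltP => [//|yx] /=.
have -> : y = x by apply/eqP; rewrite eq_le yx xy.
by rewrite subrr.
Qed.

Lemma integrable_cst_itv (c x y : R) : mu.-integrable `]x, y[ (EFin \o cst c).
Proof.
apply/integrableP; split; first exact/measurable_EFinP/measurable_cst.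
under eq_integral do rewrite /=.
rewrite integral_cst//= lebesgue_measure_itv/=.
by case: ifP => _; rewrite ?mule0// ltry.
Qed.

Lemma Rintegral_itv_le f (c x y : R) : int01 f -> 0 <= x -> x <= y -> y <= 1 ->
  (forall s : R, x < s < y -> f s <= c) -> J f x y <= c * (y - x).
Proof.
move=> fi x0 xy y1 fc; rewrite -Rintegral_itv_cst//; apply: le_Rintegral => //.
- exact: integrable_itv.
- exact: integrable_cst_itv.
Qed.

Lemma Rintegral_itv_ge f (c x y : R) : int01 f -> 0 <= x -> x <= y -> y <= 1 ->
  (forall s : R, x < s < y -> c <= f s) -> c * (y - x) <= J f x y.
Proof.
move=> fi x0 xy y1 fc; rewrite -Rintegral_itv_cst//; apply: le_Rintegral => //.
- exact: integrable_cst_itv.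
- exact: integrable_itv.
Qed.

(** Measurability is asked of [f] itself, since that of [f ^+ 2] does not determine it. *)
Definition sqint f :=
  measurable_fun (`]0, 1[%classic : set R) f /\ int01 (fun s => f s ^+ 2).

Lemma integrable_le f g : measurable_fun (`]0, 1[%classic : set R) f -> int01 g ->
  (forall s : R, 0 < s < 1 -> `|f s| <= g s) -> int01 f.
Proof.
move=> mf gi fg; apply: le_integrable gi => //.
  exact/measurable_EFinP.
move=> s; rewrite /= in_itv/= lee_fin => s01.
by rewrite (le_trans (fg s s01))// ler_norm.
Qed.

Lemma int01D f g : int01 f -> int01 g -> int01 (fun s => f s + g s).
Proof.
move=> fi gi; rewrite (_ : EFin \o _ = (EFin \o f) \+ (EFin \o g))%E//.
exact: integrableD.
Qed.

Lemma int01Z (c : R) f : int01 f -> int01 (fun s => c * f s).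
Proof.
move=> fi; rewrite (_ : EFin \o _ = fun x => (c%:E * (EFin \o f) x))%E//.
exact: integrableZl.
Qed.

Lemma sqint_mul f g : sqint f -> sqint g -> int01 (fun s => f s * g s).
Proof.
move=> [mf fi] [mg gi]; apply: (integrable_le _ (int01D fi gi)).
  exact: measurable_funM.
by move=> s _; rewrite ler_norml; apply/andP; split; nra.
Qed.

Lemma sqint_cst c : sqint (cst c).
Proof. by split => //; exact: (integrable_cst_itv (c ^+ 2)). Qed.

Lemma sqint_int f : sqint f -> int01 f.
Proof.
move=> fi; have := sqint_mul fi (sqint_cst 1).
by congr integrable; apply/funext => s /=; rewrite mulr1.
Qed.

Lemma sqintD f g : sqint f -> sqint g -> sqint (fun s => f s + g s).
Proof.
move=> [mf fi] [mg gi]; split; first exact: measurable_funD.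
apply: (integrable_le _ (int01Z 2 (int01D fi gi))).
  by apply: measurable_funX; exact: measurable_funD.
by move=> s _; rewrite ger0_norm ?sqr_ge0//; have := sqr_ge0 (f s - g s); nra.
Qed.

Lemma sqintZ (c : R) f : sqint f -> sqint (fun s => c * f s).
Proof.
move=> [mf fi]; split; first exact: measurable_funM.
have := int01Z (c ^+ 2) fi; congr integrable.
by apply/funext => s /=; rewrite exprMn.
Qed.

Lemma sqint_affine (c a b : R) f g : sqint f -> sqint g ->
  sqint (fun s => c - a * f s - b * g s).
Proof.
move=> fi gi; rewrite (_ : (fun s => _) = fun s => (c + - a * f s) + - b * g s).
  apply: sqintD; last exact: sqintZ.
  by apply: sqintD; [exact: sqint_cst|exact: sqintZ].
by apply/funext => s; ring.
Qed.

Lemma sqint_bounded f (C : R) : measurable_fun (`]0, 1[%classic : set R) f ->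
  (forall s : R, 0 < s < 1 -> `|f s| <= C) -> sqint f.
Proof.
move=> mf fC; split => //; apply: (integrable_le _ (integrable_cst_itv (C ^+ 2) 0 1)).
  exact: measurable_funX.
by move=> s s01; rewrite normrX/= lerXn2r ?nnegrE// ?fC// (le_trans _ (fC s s01)).
Qed.

Lemma inQ_sqint f : inQ f -> sqint f.
Proof.
move=> [fnd [_ foo]]; have mf : measurable_fun (`]0, 1[%classic : set R) f.
  apply: nondecreasing_in_measurable; first exact: interval_is_interval.
  by move=> x y; rewrite !inE/=; exact: fnd.
split => //; apply/integrableP; split.
  by apply/measurable_EFinP; exact: measurable_funX.
by under eq_integral do rewrite /= ger0_norm ?sqr_ge0//.
Qed.

Lemma EFin_Rintegral f (x y : R) : int01 f -> 0 <= x -> y <= 1 ->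
  (\int[mu]_(s in `]x, y[) (f s)%:E)%E = (J f x y)%:E.
Proof.
move=> fi x0 y1; rewrite /Rintegral fineK//.
by apply: integrable_fin_num => //; exact: integrable_itv.
Qed.

(* [m] is approximated within [1/n] by [1/n] times the number of [k] with
   [t_(k/n) <= s]; each such layer contributes a nonnegative integral. *)
Lemma Rintegral_mul_ge0 f (m : R -> R) (C : R) : int01 f ->
  measurable_fun (`]0, 1[%classic : set R) m -> (forall s : R, 0 < s < 1 -> 0 <= m s <= C) ->
  (forall u : R, 0 <= u -> exists t : R, [/\ 0 <= t <= 1, 0 <= J f t 1 &
    forall s : R, 0 < s < 1 -> (s < t -> m s <= u) /\ (t <= s -> u <= m s)]) ->
  0 <= J (fun s => f s * m s) 0 1.
Proof.
move=> fi mm mC layer.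
have /choice[t0 ht0] : forall u : R, exists t : R, 0 <= u -> [/\ 0 <= t <= 1, 0 <= J f t 1 &
    forall s : R, 0 < s < 1 -> (s < t -> m s <= u) /\ (t <= s -> u <= m s)].
  move=> u; have [u0|u0] := leP 0 u; last by exists 0.
  by have [t ht] := layer u u0; exists t.
pose ind (t s : R) : R := (t <= s)%R%:R.
have mind t : measurable_fun (`]0, 1[%classic : set R) (ind t).
  apply: nondecreasing_in_measurable; first exact: interval_is_interval.
  move=> x y _ _ xy; rewrite /ind ler_nat.
  by case: (leP t x) => // tx; rewrite (le_trans tx xy).
have ind01 t s : 0 <= ind t s <= 1.
  by rewrite /ind; case: (t <= s); rewrite /= ?lexx ?ler01.
have find t : int01 (fun s => f s * ind t s).
  apply: (integrable_le (g := fun s => `|f s|)).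
  - apply: measurable_funM => //; apply/measurable_EFinP; exact: (measurable_int mu).
  - by have := integrable_abse fi.
  - by move=> s _; rewrite normrM ler_piMr// ger0_norm; case/andP: (ind01 t s).
have Jind t : 0 <= t <= 1 -> J (fun s => f s * ind t s) 0 1 = J f t 1.
  move=> /andP[t0' t1]; rewrite (@RintegralD_itv _ 0 t 1)//.
  rewrite (@eq_Rintegral _ _ _ _ _ (cst 0)); last first.
    move=> s; rewrite inE/= in_itv/= => /andP[_ st].
    by rewrite /ind leNgt st mulr0.
  rewrite Rintegral_itv_cst// mul0r add0r; apply: eq_Rintegral => s.
  by rewrite inE/= in_itv/= => /andP[/ltW ts _]; rewrite /ind ts mulr1.
(* The layers at the levels [k / (n + 1)] approximate [m] up to [1 / (n + 1)], which accounts for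
   the error term [J |f| / (n + 1)]. *)
rewrite -oppr_le0; apply: (@le0_of_le_divn _ _ (J (fun s => `|f s|) 0 1)) => n.
pose t k := t0 (k%:R / n.+1%:R : R).
have un0 k : (0 : R) <= k%:R / n.+1%:R by rewrite divr_ge0.
pose S N s : R := \sum_(k < N) ind (t k) s.
have SS N s : S N.+1 s = S N s + ind (t N) s by rewrite /S big_ord_recr.
have mS N : measurable_fun (`]0, 1[%classic : set R) (S N).
  elim: N => [|N IH].
    by rewrite (_ : S 0%N = cst 0)//; apply/funext => s; rewrite /S big_ord0.
  rewrite (_ : S N.+1 = (fun s => S N s + ind (t N) s));
    by [exact: measurable_funD|exact/funext].
have fS N : int01 (fun s => f s * S N s) /\ 0 <= J (fun s => f s * S N s) 0 1.
  elim: N => [|N [IH1 IH2]].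
    rewrite (_ : (fun s => _) = cst 0); last by apply/funext => s; rewrite /S big_ord0 mulr0.
    by rewrite Rintegral_itv_cst// mul0r; split => //; exact: integrable_cst_itv.
  rewrite (_ : (fun s => _) = (fun s => f s * S N s + f s * ind (t N) s)); last first.
    by apply/funext => s; rewrite SS mulrDr.
  split; first exact: int01D.
  rewrite RintegralD// addr_ge0//.
  have [tN ftN _] := ht0 _ (un0 N).
  by rewrite Jind.
(* Induction on [N]: when [t N <= s] the level [N / (n + 1)] is at most [m s] and the count goes up
   by one; otherwise [m s] is at most that level and the count is already large enough. The middle
   bound [S N s <= N] is what carries the upper bound through the first case. *)
have Sbnd N s : 0 < s < 1 -> Num.min (n.+1%:R * m s) N%:R <= S N s
    /\ S N s <= N%:R /\ S N s <= n.+1%:R * m s + 1.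
  move=> s01; have M0 : 0 <= n.+1%:R * m s.
    by rewrite mulr_ge0//; case/andP: (mC s s01).
  elim: N => [|N [IH1 [IH2 IH3]]].
    by rewrite /S big_ord0 ge_min lexx orbT; split => //; split => //; lra.
  have [_ _ /(_ s s01)[tN1 tN2]] := ht0 _ (un0 N).
  move: tN1 tN2; rewrite -/(t N) ler_pdivlMr// ler_pdivrMr// [m s * _]mulrC.
  move=> tN1 tN2; rewrite SS -[N.+1%:R]natr1 /ind; case: (leP (t N) s) => ts /=.
    move/tN2 : ts => ts; split.
      by rewrite ge_min; apply/orP; right; move: IH1; rewrite min_r//; lra.
    by split; lra.
  move/tN1 : ts => ts; rewrite !addr0; split; last by split; lra.
  by rewrite ge_min; apply/orP; left; move: IH1; rewrite min_l.
(* Once the levels reach [C], the minimum in [Sbnd] is [n.+1%:R * m s]. *)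
have [N CN] : exists N : nat, n.+1%:R * C <= N%:R.
  by exists (Num.bound `|n.+1%:R * C|); rewrite (le_trans (ler_norm _))// ltW// archi_boundP.
have [fSi fS0] := fS N.
have fmi : int01 (fun s => f s * m s).
  apply: (integrable_le (g := fun s => C * `|f s|)).
  - apply: measurable_funM => //; apply/measurable_EFinP; exact: (measurable_int mu).
  - by apply: int01Z; have := integrable_abse fi.
  - move=> s s01; have := mC s s01; rewrite normrM mulrC => /andP[m0 mC'].
    by rewrite ler_wpM2r// ger0_norm.
rewrite ler_pdivlMr// -subr_le0.
have -> : - J (fun s => f s * m s) 0 1 * n.+1%:R - J (fun s => `|f s|) 0 1 =
  - (n.+1%:R * J (fun s => f s * m s) 0 1 + J (fun s => `|f s|) 0 1) by ring.
have fai : int01 (fun s => `|f s|) by have := integrable_abse fi.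
rewrite oppr_le0 -RintegralZl// -RintegralD//; last exact: int01Z.
apply: (le_trans fS0); apply: le_Rintegral => //; first by apply: int01D => //; exact: int01Z.
move=> s /=; rewrite in_itv/= => s01.
have [S1 [_ S2]] := Sbnd N s s01.
have {}S1 : n.+1%:R * m s <= S N s.
  move: S1; rewrite min_l//; apply: le_trans CN; rewrite ler_wpM2l//.
  by case/andP: (mC s s01).
(* The gap [S N s - n.+1%:R * m s] lies in [[0, 1]], so multiplying it by [f s] gives at most
   [|f s|]. *)
rewrite -lerBlDl [leLHS](_ : _ = f s * (S N s - n.+1%:R * m s)); last by ring.
apply: (le_trans (ler_norm _)); rewrite normrM ler_piMr// ger0_norm; lra.
Qed.

End integration.

(** * Feasibility and optimality of [qopt], for an abstract right-continuous nonincreasing [q] *)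

Section optimality.
Variables (R : realType) (Q0 q H : R -> R) (beta lambda M : R).
Notation mu := (@lebesgue_measure R).
Notation int01 f := (mu.-integrable `]0, 1[ (EFin \o f)).
Notation J f x y := (Rintegral mu `]x, y[ f).
Let h s : R := 2 * beta - lambda * q s - 2 * Q0 s.
Hypothesis lambda_gt0 : 0 < lambda.
Hypothesis mQ0 : measurable_fun (`]0, 1[%classic : set R) Q0.
Hypothesis Q0_bounded : forall s : R, 0 < s < 1 -> `|Q0 s| <= M.
Hypothesis q_sqint : sqint q.
Hypothesis q_ge0 : forall s : R, 0 < s < 1 -> 0 <= q s.
Hypothesis q_nonincreasing :
  forall x y : R, 0 < x -> x <= y -> y < 1 -> q y <= q x.
Hypothesis q_right_continuous :
  forall s : R, 0 < s < 1 -> q x @[x --> s^'+] --> q s.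
Hypothesis HE : forall s : R, 0 <= s <= 1 -> H s = J h 0 s.
Hypothesis H_continuous : {within `[0, 1], continuous H}.

Let G := concave_envelope H.
Let g := right_deriv G.
Let m s : R := Num.max (- g s) 0.
Definition qopt s : R := beta + (m s - lambda * q s) / 2.

Let Q0_sqint : sqint Q0.
Proof. exact: sqint_bounded Q0_bounded. Qed.

Let h_int : int01 h.
Proof. by apply: sqint_int; exact: sqint_affine. Qed.

Let H_diff (x y : R) : 0 <= x -> x <= y -> y <= 1 -> H y - H x = J h x y.
Proof.
move=> x0 xy y1; rewrite !HE; [|lra..].
by rewrite (RintegralD_itv h_int (lexx 0) x0 xy y1) addrC addKr.
Qed.

Let H0 : H 0 = 0.
Proof. by rewrite HE ?lexx ?ler01// set_itvoo0 Rintegral_set0. Qed.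

(** Since [lambda * q >= 0] and [Q0 >= - M], the integrand [h] is bounded above by a constant. This
    is the affine majorant that the envelope lemmas require. *)
Let H_le (x : R) : 0 <= x <= 1 -> H x <= 0 + (2 * beta + 2 * M) * x.
Proof.
move=> /andP[x0 x1]; have := H_diff (lexx 0) x0 x1.
rewrite H0 !subr0 add0r => ->.
rewrite -[X in _ * X]subr0; apply: Rintegral_itv_le => // s sx.
have s01 : 0 < s < 1 by lra.
have := Q0_bounded s01; rewrite ler_norml => Q0s.
have : 0 <= lambda * q s by rewrite mulr_ge0 ?q_ge0// ltW.
rewrite /h; lra.
Qed.

(** A line above [H] that meets it at [1]. It forces [G 1 = H 1] and keeps the slopes of [G] bounded
    near [1]. *)
Let H_le_end : exists2 C : R, 0 <= C &
  forall x : R, 0 <= x <= 1 -> H x <= (H 1 + C) + - C * x.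
Proof.
(* To the right of [1 / 2], [q] is at most [q (1 / 2)], whence [h >= - c]. To the left,
   [1 - x > 1 / 2], so the doubled terms of the constant absorb [|C0|] and [|H 1|]. *)
pose c := lambda * q (1 / 2) + 2 * M - 2 * beta.
pose C0 := 2 * beta + 2 * M.
have nc := normr_ge0 c; have nC := normr_ge0 C0; have nH := normr_ge0 (H 1).
exists (`|c| + 2 * `|C0| + 2 * `|H 1|); first lra.
move=> x /andP[x0 x1]; have [xh|xh] := leP (1 / 2) x.
  have := H_diff x0 x1 (lexx 1).
  have : - c * (1 - x) <= J h x 1.
    apply: Rintegral_itv_ge => // s xs.
    have s01 : 0 < s < 1 by lra.
    have := Q0_bounded s01; rewrite ler_norml => Q0s.
    have : lambda * q s <= lambda * q (1 / 2).
      by apply: ler_wpM2l; [exact: ltW|apply: q_nonincreasing; lra].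
    rewrite /h /c; lra.
  have := ler_norm c; nra.
have x01 : 0 <= x <= 1 by lra.
have := H_le x01; rewrite -/C0 add0r => Hx.
have : C0 * x <= `|C0| by have := ler_norm C0; nra.
have H1 : - H 1 <= `|H 1| by rewrite ler_normr lexx orbT.
nra.
Qed.

Let G_concave : concave01 G. Proof. exact: concave_envelope_concave01 H_le. Qed.

Let H_le_G (s : R) : 0 <= s <= 1 -> H s <= G s.
Proof. exact: le_concave_envelope H_le _. Qed.

Let G_le (a b s : R) : (forall x, 0 <= x <= 1 -> H x <= a + b * x) ->
  0 <= s <= 1 -> G s <= a + b * s.
Proof.
move=> Hab s01; apply: (@concave_envelope_le _ H (fun x => a + b * x)) => //.
exact: affine_concave01.
Qed.

Let G1 : G 1 = H 1.
Proof.
have [C C0 HC] := H_le_end.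
apply/eqP; rewrite eq_le H_le_G ?ler01 ?lexx// andbT.
by have := G_le HC (_ : 0 <= 1 <= 1); rewrite lexx ler01 => /(_ isT); lra.
Qed.

Let m_nondecreasing (x y : R) : 0 < x -> x <= y -> y < 1 -> m x <= m y.
Proof.
move=> x0 xy y1; rewrite /m ge_max !le_max lexx !orbT andbT lerN2.
by rewrite right_deriv_nonincreasing.
Qed.

Let m_ge0 s : 0 <= m s. Proof. by rewrite le_max lexx orbT. Qed.

Let m_measurable : measurable_fun (`]0, 1[%classic : set R) m.
Proof.
apply: nondecreasing_in_measurable; first exact: interval_is_interval.
move=> x y; rewrite !inE/= !in_itv/= => /andP[x0 _] /andP[_ y1] xy.
exact: m_nondecreasing.
Qed.

(** The line of [H_le_end] gives [- g s * (1 - s) <= G s - G 1 <= C * (1 - s)]. *)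
Let m_bounded : exists C : R, [/\ 0 <= C,
  forall s : R, 0 < s < 1 -> 0 <= m s <= C &
  forall x : R, 0 <= x <= 1 -> G x - G 1 <= C * (1 - x)].
Proof.
have [C C0 HC] := H_le_end; exists C.
have GC (x : R) : 0 <= x <= 1 -> G x - G 1 <= C * (1 - x).
  by move=> x01; have := G_le HC x01; rewrite G1; lra.
split => // s s01; rewrite m_ge0/= ge_max C0 andbT.
have s01' : 0 <= s <= 1 by lra.
have s11 : s <= (1 : R) <= 1 by lra.
have := concave_le_right_deriv G_concave s01 s11; rewrite -/g => g1.
have := GC _ s01' => g2.
rewrite lerNl -(@ler_pM2r _ (1 - s)); lra.
Qed.

Let m_sqint : sqint m.
Proof.
have [C [C0 mC _]] := m_bounded; apply: (@sqint_bounded _ _ C) => // s s01.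
by rewrite ger0_norm//; case/andP: (mC s s01).
Qed.

Let m_right_continuous (s : R) : 0 < s < 1 -> m x @[x --> s^'+] --> m s.
Proof.
move=> s01; have /cvgrPdist_le gs := right_deriv_right_continuous G_concave s01.
apply/cvgrPdist_le => e e0; near=> x.
have : `|g s - g x| <= e by near: x; exact: gs.
rewrite /m !ler_norml; case: (leP (- g s) 0) => gs0; case: (leP (- g x) 0) => gx0; lra.
Unshelve. all: by end_near. Qed.

(** Because [m >= - g] and [m] is monotone, [- G x - J m 0 x] has increments at most
    [(v y - v x) * (y - x)] over [[x, y]], so the telescoping estimate shows that it does not
    grow. *)
Let Rintegral_m_ge (t : R) : 0 <= t <= 1 -> G t - G 1 <= J m t 1.
Proof.
move=> /andP[t0 t1]; have [C [C0 mC GC]] := m_bounded.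
have m_int := sqint_int m_sqint.
(* [v] extends [m] to the endpoints by its bounds [0] and [C]. *)
pose v x : R := if x <= 0 then 0 else if x < 1 then m x else C.
have : (- G 1 - J m 0 1) <= (- G t - J m 0 t).
  apply: (@le_of_increment_le _ (fun x => - G x - J m 0 x) v) => // x y tx xy y1.
  have x0 : 0 <= x by lra.
  have x1 : x <= 1 by lra.
  have -> : J m 0 y = J m 0 x + J m x y by apply: RintegralD_itv => //; lra.
  have vx : v x * (y - x) <= J m x y.
    apply: Rintegral_itv_ge => //; first exact: ltW.
    move=> s /andP[xs sy]; rewrite /v; case: (leP x 0) => // x0'.
    by rewrite ifT ?m_nondecreasing//; lra.
  have vy : G x - G y <= v y * (y - x).
    rewrite /v [y <= 0]leNgt (le_lt_trans x0 xy)/=; case: ltP => y1'.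
      have y01 : 0 < y < 1 by lra.
      have xy' : 0 <= x <= y by lra.
      have := concave_ge_right_deriv G_concave y01 xy'; rewrite -/g.
      have : - g y <= m y by rewrite le_max lexx.
      nra.
    have -> : y = 1 by lra.
    by apply: GC; lra.
  lra.
have : J m 0 1 = J m 0 t + J m t 1 by apply: RintegralD_itv.
lra.
Qed.

(* An argmax [t] of [H s + u s] is a contact point of [H] with its envelope,
   and separates [m <= u] from [m >= u]. *)
Let layer (u : R) : 0 <= u -> exists t : R, [/\ 0 <= t <= 1,
  forall s : R, 0 < s < 1 -> (s < t -> m s <= u) /\ (t <= s -> u <= m s) &
  J m t 1 + J h t 1 = 0].
Proof.
move=> u0; have [C [C0 mC GC]] := m_bounded.
have m_int := sqint_int m_sqint.
have [|t t01 Ht] := @EVT_max R (fun s => H s + u * s) 0 1 ler01.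
  move=> x; apply: cvgD; first exact: H_continuous.
  by apply: continuous_subspaceT => y; exact: mulrl_continuous.
rewrite in_itv/= in t01; have /andP[t0 t1] := t01.
(* Maximality of [t] says that the line of slope [- u] through [(t, H t)] lies above [H], hence
   above [G]. *)
have Gu (s : R) : 0 <= s <= 1 -> G s <= (H t + u * t) + - u * s.
  apply: G_le => x x01; have := Ht x; rewrite in_itv/= => /(_ x01); lra.
have Gt : G t = H t.
  by apply/eqP; rewrite eq_le H_le_G// andbT; have := Gu t t01; lra.
have gu (s : R) : t <= s -> 0 < s < 1 -> u <= - g s.
  rewrite le_eqVlt => /predU1P[<-|ts] s01.
    rewrite lerNr; apply: right_deriv_concave_le => // y ty.
    have y01 : 0 <= y <= 1 by lra.
    by have := Gu y y01; lra.
  have ts' : 0 <= t <= s by lra.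
  have := concave_ge_right_deriv G_concave s01 ts'; rewrite -/g => g1.
  have s01' : 0 <= s <= 1 by lra.
  have := Gu s s01' => g2; rewrite -(@ler_pM2r _ (s - t)); lra.
exists t; split => //.
  move=> s s01; split=> [st|ts]; last by rewrite le_max gu.
  rewrite /m ge_max u0 andbT lerNl -(@ler_pM2r _ (t - s)); last by lra.
  have st' : s <= t <= 1 by lra.
  have := concave_le_right_deriv G_concave s01 st'; rewrite -/g.
  have s01' : 0 <= s <= 1 by lra.
  have := Gu s s01'; lra.
have := Rintegral_m_ge t01; have := H_diff t0 t1 (lexx 1).
(* With [Rintegral_m_ge] this becomes an equality, and contact at [t] and at [1] turns [G t - G 1]
   into [- J h t 1]. The reverse bound holds because [- g >= u >= 0] from [t] on, so that [m = - g]
   there. *)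
suff : J m t 1 <= G t - G 1 by rewrite G1 Gt; lra.
(* At [t], which may be an endpoint, the slope [u] given by [Gu] stands in for [m]; at [1] the bound
   [C] does. *)
pose v x : R := if x <= t then u else if x < 1 then m x else C.
have : J m 0 1 + G 1 <= J m 0 t + G t.
  apply: (@le_of_increment_le _ (fun x => J m 0 x + G x) v) => // x y tx xy y1.
  have x0 : 0 <= x by lra.
  have x1 : x <= 1 by lra.
  have -> : J m 0 y = J m 0 x + J m x y by apply: RintegralD_itv => //; lra.
  have vy : J m x y <= v y * (y - x).
    apply: Rintegral_itv_le => //; first exact: ltW.
    move=> s /andP[xs sy]; rewrite /v [y <= t]leNgt (le_lt_trans tx xy)/=.
    case: ltP => y1'; first by apply: m_nondecreasing; lra.
    by have /mC/andP[] : 0 < s < 1 by lra.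
  have vx : v x * (y - x) <= G x - G y.
    rewrite /v; case: (leP x t) => xt.
      have -> : x = t by lra.
      have y01 : 0 <= y <= 1 by lra.
      by have := Gu y y01; lra.
    have x01 : 0 < x < 1 by lra.
    have xy' : x <= y <= 1 by lra.
    have -> : (if x < 1 then m x else C) = - g x.
      rewrite ifT; last by lra.
      by rewrite /m max_l// (le_trans u0)// gu// ltW.
    by have := concave_le_right_deriv G_concave x01 xy'; rewrite -/g; lra.
  lra.
have : J m 0 1 = J m 0 t + J m t 1 by apply: RintegralD_itv.
lra.
Qed.

Lemma qopt_sqint : sqint qopt.
Proof.
rewrite (_ : qopt = fun s => beta + (2^-1 * m s + (- lambda / 2) * q s)).
  by apply: sqintD; [exact: sqint_cst|apply: sqintD; exact: sqintZ].
by apply/funext => s; rewrite /qopt; field.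
Qed.

Lemma qopt_inQ : inQ qopt.
Proof.
split; [|split].
- move=> x y; rewrite !in_itv/= => /andP[x0 _] /andP[_ y1] xy.
  have := m_nondecreasing x0 xy y1; have := q_nonincreasing x0 xy y1.
  rewrite -(ler_pM2l lambda_gt0) /qopt; lra.
- move=> s s01; apply: cvgD; first exact: cvg_cst.
  apply: cvgM; last exact: cvg_cst.
  apply: cvgB; first exact: m_right_continuous.
  by apply: cvgM; [exact: cvg_cst|exact: q_right_continuous].
- have [_ /integrableP[_]] := qopt_sqint.
  by under eq_integral do rewrite /= ger0_norm ?sqr_ge0//.
Qed.

(** Pointwise, [qopt = Q0 + (h + m) / 2]. *)
Let Rintegral_qopt (t : R) : 0 <= t <= 1 ->
  J qopt t 1 = J Q0 t 1 + (J h t 1 + J m t 1) / 2.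
Proof.
move=> /andP[t0 t1].
have itv f : int01 f -> mu.-integrable `]t, 1[ (EFin \o f).
  by move=> fi; exact: integrable_itv.
have m_int := sqint_int m_sqint.
have Q0_int := sqint_int Q0_sqint.
rewrite -RintegralD; [|by []|exact: itv..].
rewrite mulrC -RintegralZl; [|by []|by apply: itv; exact: int01D].
rewrite -RintegralD; [|by []|exact: itv|by apply: itv; apply: int01Z; exact: int01D].
by apply: eq_Rintegral => s _; rewrite /qopt /h -/(m s); field.
Qed.

Lemma qopt_icx (t : R) : 0 <= t <= 1 -> J Q0 t 1 <= J qopt t 1.
Proof.
move=> t01; have /andP[t0 t1] := t01; rewrite Rintegral_qopt// lerDl divr_ge0//.
have := Rintegral_m_ge t01; have := H_diff t0 t1 (lexx 1); have := H_le_G t01.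
rewrite G1; lra.
Qed.

(** The objective as one real integral, so that the square can be expanded under the integral
    sign. *)
Definition cost Q := J (fun s => (Q s - beta) ^+ 2 + lambda * (Q s * q s)) 0 1.

Lemma cost_integrable Q : sqint Q ->
  int01 (fun s => (Q s - beta) ^+ 2) /\ int01 (fun s => Q s * q s).
Proof.
move=> Qi; split; last exact: sqint_mul.
by have [] : sqint (fun s => Q s - beta) by apply: sqintD => //; exact: sqint_cst.
Qed.

(** The surplus [J (fun s => (Q s - qopt s) ^+ 2) 0 1] yields uniqueness as well as optimality. *)
Lemma cost_ge Q : sqint Q -> (forall t : R, 0 <= t <= 1 -> J Q0 t 1 <= J Q t 1) ->
  cost qopt + J (fun s => (Q s - qopt s) ^+ 2) 0 1 <= cost Q.
Proof.
move=> Qi icx.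
pose D s := Q s - qopt s.
have Di : sqint D.
  rewrite (_ : D = fun s => Q s + -1 * qopt s).
    by apply: sqintD => //; apply: sqintZ; exact: qopt_sqint.
  by apply/funext => s; rewrite /D; ring.
have costi P : sqint P -> int01 (fun s => (P s - beta) ^+ 2 + lambda * (P s * q s)).
  by move=> /cost_integrable[? ?]; apply: int01D => //; exact: int01Z.
have Dmi : int01 (fun s => D s * m s) by exact: sqint_mul.
have D2i : int01 (fun s => D s ^+ 2) by case: Di.
(* The term linear in [D] is [D * (2 * (qopt - beta) + lambda * q)], and the second factor is
   [m]. *)
have -> : cost Q = cost qopt + J (fun s => D s ^+ 2) 0 1 + J (fun s => D s * m s) 0 1.
  rewrite /cost -RintegralD//; last exact/costi/qopt_sqint.
  rewrite -RintegralD//; last by apply: int01D => //; exact/costi/qopt_sqint.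
  by apply: eq_Rintegral => s _; rewrite /D /qopt; field.
rewrite lerDl; have [C [C0 mC _]] := m_bounded.
apply: (@Rintegral_mul_ge0 _ D m C) => //; first exact: sqint_int.
move=> u /layer[t [t01 mu' Jt]]; exists t; split => //.
have /andP[t0 t1] := t01.
have Qt : mu.-integrable `]t, 1[ (EFin \o Q).
  by apply: integrable_itv => //; exact: sqint_int.
have qt : mu.-integrable `]t, 1[ (EFin \o qopt).
  by apply: integrable_itv => //; apply: sqint_int; exact: qopt_sqint.
by rewrite /D RintegralB// Rintegral_qopt// [J h _ _ + _]addrC Jt mul0r addr0 subr_ge0 icx.
Qed.

End optimality.

(** * From equality in mean square to pointwise equality *)

Section right_continuous.
Variable R : realType.
Notation mu := (@lebesgue_measure R).
Notation J f x y := (Rintegral mu `]x, y[ f).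

(** If [f] and [g] differ at [s], right continuity keeps [|f - g|] above half its value at [s] on
    some []s, y[], which already makes the integral positive. *)
Lemma right_continuous_eq_of_Rintegral_sqr (f g : R -> R) :
  sqint (fun s => f s - g s) ->
  (forall s : R, 0 < s < 1 -> f x @[x --> s^'+] --> f s) ->
  (forall s : R, 0 < s < 1 -> g x @[x --> s^'+] --> g s) ->
  J (fun s => (f s - g s) ^+ 2) 0 1 <= 0 ->
  forall s : R, 0 < s < 1 -> f s = g s.
Proof.
move=> [_ Di] fr gr J0 s s01; apply/eqP; rewrite -subr_eq0; apply/negPn/negP => fg.
have e0 : 0 < `|f s - g s| / 2 by rewrite divr_gt0// normr_gt0.
have /cvgrPdist_le/(_ _ e0) : (f x - g x) @[x --> s^'+] --> f s - g s.
  by apply: cvgB; [exact: fr|exact: gr].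
rewrite near_withinE => /nbhs_ballP[d /= d0 hd].
pose y := Num.min (s + d) 1.
have /andP[s0 s1] := s01.
have sy : s < y by rewrite lt_min; apply/andP; split => //; lra.
have y1 : y <= 1 by rewrite ge_min lexx orbT.
have yd : y <= s + d by rewrite ge_min lexx.
have : (`|f s - g s| / 2) ^+ 2 * (y - s) <= J (fun s => (f s - g s) ^+ 2) s y.
  apply: Rintegral_itv_ge => //; [exact: ltW|exact: ltW|] => x /andP[sx xy].
  have := hd x; rewrite /ball/= => /(_ _ sx) hx.
  have {}hx : `|f s - g s - (f x - g x)| <= `|f s - g s| / 2.
    by apply: hx; rewrite ltr_distlC; lra.
  rewrite -[leRHS]real_normK ?num_real// lerXn2r ?nnegrE ?divr_ge0//.
  have := ler_normD (f s - g s - (f x - g x)) (f x - g x).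
  rewrite subrK; lra.
have : 0 < (`|f s - g s| / 2) ^+ 2 * (y - s).
  by rewrite mulr_gt0 ?exprn_gt0// subr_gt0.
have J1 := RintegralD_itv Di (lexx 0) (ltW s0) (ltW s1) (lexx 1).
have J2 := RintegralD_itv Di (ltW s0) (ltW sy) y1 (lexx 1).
have : 0 <= J (fun s => (f s - g s) ^+ 2) 0 s by apply: Rintegral_ge0 => x _; exact: sqr_ge0.
have : 0 <= J (fun s => (f s - g s) ^+ 2) y 1 by apply: Rintegral_ge0 => x _; exact: sqr_ge0.
lra.
Qed.

End right_continuous.

(** * The right-continuous version of a reversed monotone function *)

Section left_limit.
Variables (R : realType) (q : R -> R).
Notation mu := (@lebesgue_measure R).
Notation int01 f := (mu.-integrable `]0, 1[ (EFin \o f)).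
Hypothesis q_nondecreasing : forall x y : R, 0 < x -> x <= y -> y < 1 -> q x <= q y.
Hypothesis q_ge0 : forall s : R, 0 < s < 1 -> 0 <= q s.

(** Under the reversal [s |-> 1 - s] a left limit turns into a right limit; for nondecreasing [q]
    this is the right-continuous version of [q (1 - s)]. *)
Definition left_lim_rev s : R := left_lim q (1 - s).
Local Notation qt := left_lim_rev.

Let S s : set R := [set q (1 - x) | x in `]s, 1[].

Let S_sup (s : R) : 0 < s < 1 -> has_sup (S s).
Proof.
move=> s01; split.
  by exists (q (1 - (s + 1) / 2)), ((s + 1) / 2) => //=; rewrite in_itv/=; lra.
exists (q (1 - s)) => _ [x /= + <-]; rewrite in_itv/= => sx.
by apply: q_nondecreasing; lra.
Qed.

(** The left limit of a nondecreasing function is the supremum of its values to the left; in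
    particular the [lim] exists. *)
Let qtE (s : R) : 0 < s < 1 -> qt s = sup (S s).
Proof.
move=> s01; apply: cvg_lim => //; apply/cvgrPdist_le => e e0.
have [_ [x0 /= + <-]] := sup_adherent e0 (S_sup s01).
rewrite in_itv/= => /andP[sx0 x01] hx0; near=> y.
have ys : y < 1 - s by near: y; exact: nbhs_left_lt.
have yx0 : 1 - x0 < y by near: y; apply: nbhs_left_gt; lra.
have qy : q (1 - x0) <= q y by apply: q_nondecreasing; lra.
have : q y <= sup (S s).
  apply: ub_le_sup; first by case: (S_sup s01).
  exists (1 - y) => /=; first by rewrite in_itv/=; lra.
  by have -> : 1 - (1 - y) = y by ring.
by move=> yS; rewrite ler_norml; lra.
Unshelve. all: by end_near. Qed.

(** With [qt_le] this gives the sandwich [q (1 - x) <= qt s <= q (1 - s)] for [s < x], on which the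
    rest of the section relies. *)
Let ge_qt (s x : R) : 0 < s -> s < x -> x < 1 -> q (1 - x) <= qt s.
Proof.
move=> s0 sx x1; have s01 : 0 < s < 1 by lra.
rewrite qtE//; apply: ub_le_sup; first by case: (S_sup s01).
by exists x => //=; rewrite in_itv/= sx.
Qed.

Let qt_le (s : R) : 0 < s < 1 -> qt s <= q (1 - s).
Proof.
move=> s01; rewrite qtE//; apply: ge_sup; first by case: (S_sup s01).
move=> _ [x /= + <-]; rewrite in_itv/= => sx.
by apply: q_nondecreasing; lra.
Qed.

Lemma left_lim_rev_ge0 (s : R) : 0 < s < 1 -> 0 <= qt s.
Proof.
move=> s01; apply: (@le_trans _ _ (q (1 - (s + 1) / 2))).
  by apply: q_ge0; lra.
by apply: ge_qt; lra.
Qed.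

Lemma left_lim_rev_nonincreasing (x y : R) : 0 < x -> x <= y -> y < 1 -> qt y <= qt x.
Proof.
move=> x0; rewrite le_eqVlt => /predU1P[->//|xy y1].
apply: (@le_trans _ _ (q (1 - y))); first by apply: qt_le; lra.
by apply: ge_qt.
Qed.

Lemma left_lim_rev_right_continuous (s : R) : 0 < s < 1 ->
  qt x @[x --> s^'+] --> qt s.
Proof.
move=> s01; apply/cvgrPdist_le => e e0.
have [_ [x0 /= + <-]] := sup_adherent e0 (S_sup s01).
rewrite -qtE// in_itv/= => /andP[sx0 x01] hx0; near=> y.
have sy : s < y by near: y; exact: nbhs_right_gt.
have yx0 : y < x0 by near: y; exact: nbhs_right_lt.
have y0 : 0 < y by lra.
have h1 := ge_qt y0 yx0 x01.
have h2 : qt y <= qt s by apply: left_lim_rev_nonincreasing; lra.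
by rewrite ler_norml; lra.
Unshelve. all: by end_near. Qed.

(* The jumps of a monotone function are separated by rationals. *)
Lemma left_lim_rev_ae :
  {ae mu, forall s, `]0, 1[%classic s -> q (1 - s) = qt s}.
Proof.
pose D := [set s : R | 0 < s < 1 /\ qt s < q (1 - s)].
suff cD : countable D.
  exists D; split; first exact: countable_measurable.
    exact: countable_lebesgue_measure0.
  move=> s /= /not_implyP[]; rewrite in_itv/= => s01 /eqP qs; split => //.
  by rewrite lt_neqAle eq_sym qs qt_le.
have /choice[r hr] : forall s : R, exists r : rat, D s -> qt s < ratr r < q (1 - s).
  move=> s; have [[_ Ds]|nD] := pselect (D s); last by exists 0.
  by have [r] := rat_in_itvoo Ds; rewrite in_itv/= => hr; exists r.
apply/countable_injP; exists (fun s => pickle (r s)) => x y /set_mem Dx /set_mem Dy.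
move=> /(pcan_inj pickleK) rxy; apply/eqP; apply/negPn/negP => xy.
wlog : x y Dx Dy rxy xy / x < y => [hw|ltxy].
  have := xy; rewrite neq_lt => /orP[|]; first exact: hw.
  by apply: hw => //; rewrite eq_sym.
have /andP[h1 _] := hr x Dx; have /andP[_ h2] := hr y Dy.
have [/andP[x0 _] _] := Dx; have [/andP[_ y1] _] := Dy.
have := ge_qt x0 ltxy y1; rewrite -rxy in h2.
by rewrite leNgt (lt_trans h1 h2).
Qed.

Lemma left_lim_rev_sqint : sqint (fun s => q (1 - s)) -> sqint qt.
Proof.
move=> [_ qi]; have mqt : measurable_fun (`]0, 1[%classic : set R) qt.
  rewrite -[qt]opprK; apply: measurable_funN.
  apply: nondecreasing_in_measurable; first exact: interval_is_interval.
  move=> x y; rewrite !inE/= !in_itv/= => /andP[x0 _] /andP[_ y1] xy.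
  by rewrite lerN2 left_lim_rev_nonincreasing.
split => //; apply: integrable_le qi _; first exact: measurable_funX.
move=> s s01; rewrite ger0_norm ?sqr_ge0// lerXn2r ?nnegrE ?qt_le ?left_lim_rev_ge0//.
by apply: q_ge0; lra.
Qed.

End left_limit.

(** * Upper quantiles of a random variable that is bounded below *)

Section quantile.
Variables (R : realType) (d : measure_display) (T : measurableType d).
Variables (P : probability T R) (X : T -> R) (L : R).
Notation mu := (@lebesgue_measure R).
Hypothesis mX : measurable_fun setT X.
Hypothesis X_ge : {ae P, forall w, L <= X w}.
Local Notation Q := (upper_quantile P X).
Let XRV : {RV P >-> R} := mfun_Sub (mem_set mX).

Let F x := P [set w | (X w <= x)%R].

Lemma measurable_sublevel x : measurable [set w | (X w <= x)%R].
Proof.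
have := mX measurableT (measurable_itv `]-oo, x]); rewrite setTI.
by congr measurable; apply/seteqP; split => w /=; rewrite in_itv.
Qed.

Let F_lt (x : R) : x < L -> F x = 0%E.
Proof.
move=> xL; apply/eqP; rewrite -measure_le0.
have mF := measurable_sublevel; have [N [mN PN hN]] := X_ge.
rewrite -PN; apply: le_measure; rewrite ?inE//.
by move=> w /= Xw; apply: hN => /= LX; lra.
Qed.

(** The set is nonempty because the distribution function tends to [1 > s], and bounded below
    because that function vanishes below [L]; so the [inf] in [upper_quantile] is a true infimum. *)
Lemma has_inf_quantile (s : R) : 0 <= s < 1 ->
  has_inf [set x : R | (s%:E < P [set w | (X w <= x)%R])%E].
Proof.
move=> /andP[s0 s1]; split.
  have [M [_ hM]] := @cvg_cdfy1 _ _ _ P XRV _ (nbhs_open_ereal_gt (f := fun=> s) s1).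
  exists (M + 1); have := hM (M + 1); rewrite ltrDl => /(_ ltr01) /=.
  congr (_ < P _)%E; apply/seteqP; split => w /=; by rewrite in_itv.
exists L => x /=; rewrite -/(F x); apply: contraTT; rewrite -!ltNge => /F_lt ->.
by rewrite -leNgt.
Qed.

Lemma quantile_ge (s : R) : 0 < s < 1 -> L <= Q s.
Proof.
move=> s01; have [|ne _] := @has_inf_quantile s; first by lra.
apply: lb_le_inf => // x /=; rewrite -/(F x); apply: contraTT.
by rewrite -!ltNge => /F_lt ->; rewrite -leNgt lee_fin; lra.
Qed.

Lemma quantile_nondecreasing (x y : R) : 0 < x -> x <= y -> y < 1 -> Q x <= Q y.
Proof.
move=> x0 xy y1.
have [|_ lb] := @has_inf_quantile x; first by lra.
have [|ne _] := @has_inf_quantile y; first by lra.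
apply: lb_le_inf => // z /= yz; apply: ge_inf => //=.
by apply: le_lt_trans yz; rewrite lee_fin.
Qed.

Lemma quantile_le (M s : R) : {ae P, forall w, X w <= M} -> 0 < s < 1 -> Q s <= M.
Proof.
move=> XM s01; have [|_ lb] := @has_inf_quantile s; first by lra.
apply: ge_inf => //=; rewrite -/(F M).
suff -> : F M = 1%E by rewrite lte_fin; lra.
have mF := measurable_sublevel.
rewrite /F -[[set w | _]]setCK probability_setC; last exact: measurableC.
rewrite (_ : P _ = 0%E) ?sube0//; apply/eqP; rewrite -measure_le0.
have [N [mN PN hN]] := XM.
rewrite -PN; apply: le_measure; rewrite ?inE//; first exact: measurableC.
Qed.

(** Otherwise [y] would belong to the set whose infimum is [Q s]. *)
Lemma quantile_gt (y s : R) : 0 < s < 1 -> y < Q s -> (F y <= s%:E)%E.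
Proof.
move=> s01; apply: contraTT; rewrite -!ltNge -leNgt => sF.
have [|_ lb] := @has_inf_quantile s; first by lra.
exact: ge_inf.
Qed.

End quantile.

(** * Square integrability of the reversed quantile, by comparison of tails *)

Section quantile_sqint.
Variables (R : realType) (d : measure_display) (T : measurableType d).
Variables (P : probability T R) (X : T -> R).
Notation mu := (@lebesgue_measure R).
Hypothesis mX : measurable_fun setT X.
Hypothesis X_ge0 : {ae P, forall w, 0 <= X w}.
Hypothesis X_sqint : P.-integrable setT (EFin \o (fun w => X w ^+ 2)).
Local Notation Q := (upper_quantile P X).
Let U : probability _ R := uniform_prob (@ltr01 R).

Let q s := Q (1 - s).

Let q_measurable : measurable_fun (`]0, 1[%classic : set R) q.
Proof.
rewrite -[q]opprK; apply: measurable_funN.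
apply: nondecreasing_in_measurable; first exact: interval_is_interval.
move=> x y; rewrite !inE/= !in_itv/= => /andP[x0 x1] /andP[y0 y1] xy.
by rewrite lerN2; apply: (quantile_nondecreasing mX X_ge0); lra.
Qed.

(** Extension by zero makes [q ^+ 2] a random variable on the whole line under the uniform law
    [U]. *)
Let Y : R -> R := (fun s => q s ^+ 2) \_ `]0, 1[.

Let mY : measurable_fun setT Y.
Proof.
apply: (measurable_restrictT _ _).1; first exact: measurable_itv.
exact: (measurable_funX _ q_measurable).
Qed.

Let mX2 : measurable_fun setT (fun w => X w ^+ 2).
Proof. exact: measurable_funX. Qed.

Let YRV : {RV U >-> R} := @mfun_Sub _ _ (measurableTypeR R) R Y (mem_set mY).
Let XRV : {RV P >-> R} := mfun_Sub (mem_set mX2).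

Let Y_ge0 s : 0 <= Y s.
Proof. by rewrite /Y patchE; case: ifP => // _; exact: sqr_ge0. Qed.

Let U_le (A : set R) (p : R) : measurable A -> 0 <= p -> A `<=` `]0, p] -> (U A <= p%:E)%E.
Proof.
move=> mA p0 Ap; apply: (@le_trans _ _ (\int[mu]_(x in A) 1)%E).
  apply: ge0_le_integral => //.
  - by move=> x _; rewrite lee_fin uniform_pdf_ge0.
  - apply/measurable_EFinP; apply: measurable_funTS; exact: measurable_uniform_pdf.
  - move=> x _; rewrite lee_fin /uniform_pdf; case: ifP => // _.
    by rewrite subr0 invr1.
rewrite integral_cst// mul1e; apply: (@le_trans _ _ (mu `]0, p]%classic)).
  by apply: le_measure; rewrite ?inE.
by rewrite lebesgue_measure_itv/= lte_fin; case: ifP => _; rewrite ?oppr0 ?adde0// lee_fin.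
Qed.

(** If [q s ^+ 2 > r], then [Q (1 - s)] exceeds the root of [r], so [X] is at most that root with
    probability at most [1 - s]. Hence [s <= p], and the event lies in []0, p]], whose uniform mass
    is at most [p]. *)
Let ccdf_le (r : R) : 0 <= r -> (ccdf YRV r <= ccdf XRV r)%E.
Proof.
move=> r0; pose p := fine (ccdf XRV r).
have pE : ccdf XRV r = p%:E by rewrite /p fineK// fin_num_measure.
rewrite pE; apply: U_le.
- by rewrite -[_ @^-1` _]setTI; exact: mY.
- exact: fine_ge0.
move=> s /=; rewrite !in_itv/= andbT /Y patchE; case: ifPn => [|_]; last by rewrite ltNge r0.
rewrite inE/= in_itv/= => s01 rq; have /andP[-> _] /= := s01.
have q0 : 0 <= q s by apply: (quantile_ge mX X_ge0); lra.
have sq : Num.sqrt r < q s by rewrite -(ger0_norm q0) -sqrtr_sqr ltr_sqrt// (le_lt_trans r0).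
have s01' : 0 < 1 - s < 1 by lra.
have := quantile_gt mX X_ge0 s01' sq.
set A := [set w | _] => PA.
have mA : measurable A by exact: measurable_sublevel.
have aE : P A = (fine (P A))%:E by rewrite fineK// fin_num_measure.
rewrite -lee_fin -pE; apply: (@le_trans _ _ (P (~` A))).
  by rewrite probability_setC// aE -EFinB lee_fin; move: PA; rewrite aE lee_fin; lra.
apply: le_measure; rewrite ?inE.
- exact: measurableC.
- by rewrite -[_ @^-1` _]setTI; exact: mX2.
move=> w /= /negP; rewrite -ltNge in_itv/= andbT => Xw.
by rewrite -(sqr_sqrtr r0) ltrXn2r// ?nnegrE ?sqrtr_ge0// ltW// (le_lt_trans _ Xw)// sqrtr_ge0.
Qed.

(** Both second moments are integrals of tail functions, so the tail comparison bounds the integral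
    of [q ^+ 2] by the expectation of [X ^+ 2]. *)
Lemma quantile_rev_sqint : sqint q.
Proof.
split => //; apply/integrableP; split.
  by apply/measurable_EFinP; exact: measurable_funX.
under eq_integral do rewrite /= ger0_norm ?sqr_ge0//.
have -> : (\int[mu]_(s in `]0%R, 1%R[) (q s ^+ 2)%:E = 'E_U[YRV])%E.
  rewrite expectation_def integral_uniform//.
  - rewrite subr0 invr1 mul1e integral_itv_bndoo.
      by apply: eq_integral => s sI; rewrite /= /Y patchE sI.
    by apply/measurable_EFinP; exact: measurable_funTS.
  - by apply/measurable_EFinP; exact: mY.
rewrite ge0_expectation_ccdf//.
apply: (@le_lt_trans _ _ ('E_P[XRV])%E).
  rewrite ge0_expectation_ccdf; last by move=> w; exact: sqr_ge0.
  apply: ge0_le_integral => //.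
  - by apply: measurable_funTS; exact: ccdf_measurable.
  - by apply: measurable_funTS; exact: ccdf_measurable.
  - by move=> r /=; rewrite in_itv/= andbT; exact: ccdf_le.
rewrite expectation_def; have /integrableP[_] := X_sqint.
by under eq_integral do rewrite /= ger0_norm ?sqr_ge0//.
Qed.

End quantile_sqint.

(** * The problem stated with quantile functions: existence and uniqueness *)

Section quantile_problem.
Variables (R : realType) (Q0 Qrho : R -> R) (beta lambda M : R).
Notation mu := (@lebesgue_measure R).
Notation int01 f := (mu.-integrable `]0, 1[ (EFin \o f)).
Notation J f x y := (Rintegral mu `]x, y[ f).
Hypothesis lambda_gt0 : 0 < lambda.
Hypothesis mQ0 : measurable_fun (`]0, 1[%classic : set R) Q0.
Hypothesis Q0_bounded : forall s : R, 0 < s < 1 -> `|Q0 s| <= M.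
Hypothesis Qrho_nondecreasing :
  forall x y : R, 0 < x -> x <= y -> y < 1 -> Qrho x <= Qrho y.
Hypothesis Qrho_ge0 : forall s : R, 0 < s < 1 -> 0 <= Qrho s.
Hypothesis Qrho_sqint : sqint (fun s => Qrho (1 - s)).

Let q := left_lim_rev Qrho.
Let H := Hfun Q0 Qrho beta lambda.
Let h0 t : R := 2 * beta - lambda * Qrho (1 - t) - 2 * Q0 t.

Let q_sqint : sqint q. Proof. exact: left_lim_rev_sqint. Qed.

Let Q0_sqint : sqint Q0. Proof. exact: sqint_bounded Q0_bounded. Qed.

Let sqint_h (p : R -> R) : sqint p ->
  sqint (fun s => 2 * beta - lambda * p s - 2 * Q0 s).
Proof. by move=> pi; exact: sqint_affine. Qed.

Let h0_int : mu.-integrable `[0, 1] (EFin \o h0).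
Proof.
have [mh0 _] := sqint_h Qrho_sqint.
have /integrableP[_ h0oo] := sqint_int (sqint_h Qrho_sqint).
apply/integrableP; split.
  by apply/measurable_EFinP; exact: measurable_fun_itv_cc mh0.
rewrite integral_itv_bndoo//.
by apply: measurableT_comp => //; exact/measurable_EFinP.
Qed.

(** [Hfun] integrates [Qrho (1 - t)] over a closed interval; the endpoints are null, and [q] differs
    from that function only on a null set. *)
Let HE (s : R) : 0 <= s <= 1 ->
  H s = J (fun t => 2 * beta - lambda * q t - 2 * Q0 t) 0 s.
Proof.
move=> /andP[s0 s1].
have sub : `]0, s[ `<=` (`]0, 1[%classic : set R).
  by apply: subset_itvl; rewrite bnd_simp.
have mh (p : R -> R) : sqint p -> measurable_fun (`]0, s[%classic : set R)
    (EFin \o (fun t => 2 * beta - lambda * p t - 2 * Q0 t)).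
  by move=> /sqint_h[mp _]; apply/measurable_EFinP; exact: measurable_funS mp.
rewrite /H /Hfun /Rintegral integral_itv_bndoo; last exact: mh Qrho_sqint.
congr fine; apply: ae_eq_integral => //; [exact: mh Qrho_sqint|exact: mh q_sqint|].
have [N [mN N0 hN]] := left_lim_rev_ae Qrho_nondecreasing.
exists N; split => //; apply: subset_trans hN; apply: subsetC => t /= qt /sub t01.
by rewrite qt.
Qed.

Let H_continuous : {within `[0, 1], continuous H}.
Proof. exact: parameterized_integral_continuous. Qed.

Let objectiveE Q : sqint Q ->
  objective Qrho beta lambda Q = (cost q beta lambda Q)%:E.
Proof.
move=> Qi; have [Qb Qq] := cost_integrable beta q_sqint Qi.
rewrite /objective /oo01.
have -> : (\int[mu]_(s in `]0%R, 1%R[) (Q s * Qrho (1 - s))%:E =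
    \int[mu]_(s in `]0%R, 1%R[) (Q s * q s)%:E)%E.
  apply: ae_eq_integral => //.
  - exact: (measurable_int mu (sqint_mul Qi Qrho_sqint)).
  - exact: (measurable_int mu Qq).
  - have [N [mN N0 hN]] := left_lim_rev_ae Qrho_nondecreasing.
    exists N; split => //; apply: subset_trans hN; apply: subsetC => t /= qt t01.
    by rewrite qt.
rewrite !EFin_Rintegral// -EFinM -EFinD /cost RintegralD//; last exact: int01Z.
by rewrite RintegralZl.
Qed.

(** A conversion: [left_lim_rev Qrho s] unfolds to the left limit that appears in [Qstar]. *)
Let QstarE : Qstar Q0 Qrho beta lambda = qopt q H beta lambda.
Proof. by []. Qed.

Let opt_inQ : inQ (Qstar Q0 Qrho beta lambda).
Proof.
rewrite QstarE; apply: (@qopt_inQ _ Q0 q H beta lambda M) => //.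
- exact: left_lim_rev_ge0.
- exact: left_lim_rev_nonincreasing.
- exact: left_lim_rev_right_continuous.
Qed.

Let icx_geE Q1 Q2 : sqint Q1 -> sqint Q2 -> icx_ge Q1 Q2 <->
  forall t : R, 0 <= t <= 1 -> J Q2 t 1 <= J Q1 t 1.
Proof.
move=> /sqint_int i1 /sqint_int i2; rewrite /icx_ge /ooT1.
by split => h t t01; have := h t t01; have /andP[t0 _] := t01;
  rewrite !EFin_Rintegral// lee_fin.
Qed.

Let Qstar_cost Q : inQ Q -> icx_ge Q Q0 ->
  cost q beta lambda (Qstar Q0 Qrho beta lambda) +
  J (fun s => (Q s - Qstar Q0 Qrho beta lambda s) ^+ 2) 0 1 <= cost q beta lambda Q.
Proof.
move=> /inQ_sqint Qi /(icx_geE Qi Q0_sqint) icx.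
apply: (@cost_ge _ Q0 q H beta lambda M) => //.
- exact: left_lim_rev_ge0.
- exact: left_lim_rev_nonincreasing.
Qed.

Lemma Qstar_is_solution : is_solution Q0 Qrho beta lambda (Qstar Q0 Qrho beta lambda).
Proof.
split => //.
- apply/(icx_geE (inQ_sqint opt_inQ) Q0_sqint) => t t01.
  apply: (@qopt_icx _ Q0 q H beta lambda M) => //.
  + exact: left_lim_rev_ge0.
  + exact: left_lim_rev_nonincreasing.
- move=> Q iQ icx; rewrite !objectiveE//; [|exact: inQ_sqint..].
  rewrite lee_fin (le_trans _ (Qstar_cost iQ icx))// lerDl.
  by apply: Rintegral_ge0 => s _; exact: sqr_ge0.
Qed.

(** Minimality of [Q] leaves no room for the surplus in [Qstar_cost], so the squared distance
    integrates to at most [0]; right continuity of both functions then gives equality at every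
    point. *)
Lemma Qstar_unique Q : is_solution Q0 Qrho beta lambda Q ->
  forall s : R, 0 < s < 1 -> Q s = Qstar Q0 Qrho beta lambda s.
Proof.
move=> [iQ icxQ /(_ (Qstar Q0 Qrho beta lambda))].
have [_ icx _] := Qstar_is_solution.
move=> /(_ opt_inQ icx); rewrite !objectiveE ?lee_fin; [|exact: inQ_sqint..] => le.
have [_ [Qr _]] := iQ; have [_ [optr _]] := opt_inQ.
apply: right_continuous_eq_of_Rintegral_sqr => //.
  rewrite (_ : (fun s => _) = fun s => Q s + -1 * Qstar Q0 Qrho beta lambda s).
    by apply: sqintD; [exact: inQ_sqint|apply: sqintZ; exact: inQ_sqint].
  by apply/funext => s; ring.
by have := Qstar_cost iQ icxQ; lra.
Qed.

End quantile_problem.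

(** * From the random variables to their quantile functions *)

Unset Implicit Arguments.

Theorem theorem6p1 (R : realType) (d : measure_display) (T : measurableType d)
  (P : probability T R)
  (P_complete : measure_is_complete P) (P_nonatomic : nonatomic P)
  (X0 rho : T -> R)
  (X0_meas : measurable_fun setT X0)
  (X0_Linfty : exists M : R, {ae P, forall w, `|X0 w| <= M})
  (rho_L2 : rho \in Lfun P 2%:E)
  (rho_pos : {ae P, forall w, 0 < rho w})
  (rho_var : (0 < 'V_P[rho])%E)
  (beta lambda : R) (lambda_pos : 0 < lambda) :
  let Q0 := upper_quantile P X0 in
  let Qrho := upper_quantile P rho in
  is_solution Q0 Qrho beta lambda (Qstar Q0 Qrho beta lambda) /\
  forall Q, is_solution Q0 Qrho beta lambda Q ->
    forall s, 0 < s < 1 -> Q s = Qstar Q0 Qrho beta lambda s.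
Proof.
move=> Q0 Qrho; have [M X0M] := X0_Linfty.
have X0_ge : {ae P, forall w, - M <= X0 w}.
  by apply: filterS X0M => w; rewrite ler_norml => /andP[].
have X0_le : {ae P, forall w, X0 w <= M}.
  by apply: filterS X0M => w; rewrite ler_norml => /andP[].
have rho_ge0 : {ae P, forall w, 0 <= rho w} by apply: filterS rho_pos => w /ltW.
have mrho : measurable_fun setT rho by have := sub_Lfun_mfun rho_L2; rewrite inE.
have mQ0 : measurable_fun (`]0, 1[%classic : set R) Q0.
  apply: nondecreasing_in_measurable; first exact: interval_is_interval.
  move=> x y; rewrite !inE/= !in_itv/= => /andP[x0 _] /andP[_ y1] xy.
  exact: (quantile_nondecreasing X0_meas X0_ge).
have Q0M (s : R) : 0 < s < 1 -> `|Q0 s| <= M.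
  move=> s01; rewrite ler_norml (quantile_ge X0_meas X0_ge s01).
  exact: (quantile_le X0_meas X0_ge X0_le s01).
have rho2 := quantile_rev_sqint mrho rho_ge0 (Lfun2_integrable_sqr rho_L2).
split.
- apply: (@Qstar_is_solution _ _ _ _ _ M) => //.
  + exact: (quantile_nondecreasing mrho rho_ge0).
  + exact: (quantile_ge mrho rho_ge0).
- apply: (@Qstar_unique _ _ _ _ _ M) => //.
  + exact: (quantile_nondecreasing mrho rho_ge0).
  + exact: (quantile_ge mrho rho_ge0).
Qed.
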